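(* Let $n\geq 1$, let $g:[0,\infty)\to\mathbb{R}$ be continuous with $g(0)=0$, and let $\mu$ be a Borel measure on $\mathbb{R}^n$ with $0<\mu(\mathbb{R}^n)<\infty$. Let $v(y)=g(|y|)\,y/|y|$ for $y\neq 0$ and $v(0)=0$, and, when $g$ is bounded, let $V(x)=V_\mu(x)=\int_{\mathbb{R}^n} v(x+y)\,d\mu(y)$ for $x\in\mathbb{R}^n$. (a) [Existence] If $g$ has a positive and finite limit at infinity, $0<g(\infty)<\infty$, then $V(x_c)=0$ for some $x_c\in\mathbb{R}^n$. (b) [Uniqueness] If either (i) $g$ is strictly increasing and bounded, or (ii) $g$ is increasing and bounded, with $g(r)>0$ for all $r>0$, and the measure $\mu$ is not supported in a line, then the point $x_c$ with $V(x_c)=0$ is unique. (c) [Continuous dependence] Suppose $\mu_k\to\mu$ weakly as $k\to\infty$, where the $\mu_k$ ($k=1,2,3,\dots$) are Borel measures on $\mathbb{R}^n$ satisfying $0<\mu_k(\mathbb{R}^n)<\infty$ for all $k$. If either (i) holds, or else (ii) holds for $\mu$ and also for each $\mu_k$ (in place of $\mu$), then $x_c(\mu_k)\to x_c(\mu)$ as $k\to\infty$, where $x_c(\nu)$ denotes the unique zero of $V_\nu(x)=\int_{\mathbb{R}^n} v(x+y)\,d\nu(y)$.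
   Context: ''Increasing'' means non-strictly increasing (nondecreasing). $g(\infty)=\lim_{r\to\infty}g(r)$ denotes the limiting value of $g$ at infinity when that limit exists. ''$\mu$ is not supported in a line'' means $\mu(\mathbb{R}^n\setminus L)>0$ for every (affine) line $L$ in $\mathbb{R}^n$. Weak convergence $\mu_k\to\mu$ means $\int_{\mathbb{R}^n}\psi\,d\mu_k\to\int_{\mathbb{R}^n}\psi\,d\mu$ as $k\to\infty$ for each bounded continuous function $\psi$ on $\mathbb{R}^n$. The measures are not assumed to have compact support. *)

(* Defs.v *)
From HB Require Import structures.
From mathcomp Require Import all_boot all_order all_algebra.
From mathcomp Require Import all_classical all_reals all_analysis.

Set Implicit Arguments.
Unset Strict Implicit.
Unset Printing Implicit Defensive.

Import Order.TTheory GRing.Theory Num.Theory.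
Import numFieldNormedType.Exports.

Local Open Scope classical_set_scope.
Local Open Scope ring_scope.

(* Row vectors with the sigma-algebra generated by the open sets. The library's
   topology on matrices is the product topology, i.e. the Euclidean one. *)
Notation borel_rV R n := (g_sigma_algebraType (@open 'rV[R]_n)).

(* The library's norm on matrices is the sup norm. *)
Definition enorm (R : realType) (n : nat) (y : 'rV[R]_n) : R :=
  Num.sqrt (\sum_(i < n) (y ord0 i) ^+ 2).

Definition vfield (R : realType) (n : nat) (g : R -> R) (y : 'rV[R]_n) :
    'rV[R]_n :=
  if y == 0 then 0 else g (enorm y) *: ((enorm y)^-1 *: y).

(* The vector-valued integral is taken coordinatewise. It is meaningful when g
   is continuous and bounded on [0, +oo[ and mu is finite. *)
Definition Vfield (R : realType) (n : nat) (g : R -> R)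
    (mu : {measure set (borel_rV R n) -> \bar R}) (x : 'rV[R]_n) : 'rV[R]_n :=
  \row_(i < n) \int[mu]_y (vfield g (x + y)) ord0 i.

(* Some zero of Vfield g mu, hence the zero when there is exactly one. The
   default value 0 is only taken if there is no zero. *)
Definition x_c (R : realType) (n : nat) (g : R -> R)
    (mu : {measure set (borel_rV R n) -> \bar R}) : 'rV[R]_n :=
  xget 0 [set x | Vfield g mu x = 0].

Definition is_line (R : realType) (n : nat) (L : set 'rV[R]_n) : Prop :=
  exists a d : 'rV[R]_n, d != 0 /\ L = [set a + t *: d | t in [set: R]].

Definition not_supported_in_line (R : realType) (n : nat)
    (mu : {measure set (borel_rV R n) -> \bar R}) : Prop :=
  forall L : set 'rV[R]_n, is_line L -> (0 < mu (~` L))%E.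

Definition weak_cvg (R : realType) (n : nat)
    (mu_ : nat -> {measure set (borel_rV R n) -> \bar R})
    (mu : {measure set (borel_rV R n) -> \bar R}) : Prop :=
  forall psi : 'rV[R]_n -> R, continuous psi -> bounded_fun psi ->
    (\int[mu_ k]_y psi y) @[k --> \oo] --> \int[mu]_y psi y.

Definition sincr_bounded (R : realType) (g : R -> R) : Prop :=
  {in `[0, +oo[ &, {homo g : r s / r < s}} /\ [bounded g r | r in `[0, +oo[].

Definition incr_bounded_not_line (R : realType) (n : nat) (g : R -> R)
    (mu : {measure set (borel_rV R n) -> \bar R}) : Prop :=
  [/\ {in `[0, +oo[ &, {homo g : r s / r <= s}},
      [bounded g r | r in `[0, +oo[],
      forall r : R, 0 < r -> 0 < g r
    & not_supported_in_line mu].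

(* Main.v *)
(* Let G be a primitive of g. The field V is the gradient of the energy
   E(x) = int (G|x+y| - G|y|) dmu(y), so zeros of V are the critical points of
   E. If g is eventually bounded below by a positive constant, E is positive
   outside a ball while E(0) = 0, so E has a minimizer. If g is increasing, then
   G|b| - G|a| >= v(a).(b - a), with equality only for parallel a, b (only for
   a = b if g is strictly increasing); integrating, E is strictly convex, which
   gives uniqueness. For the continuous dependence, the energies E_k converge
   pointwise to E and are equi-Lipschitz, so on a small sphere around the
   minimizer x0 of E they eventually exceed E_k(x0), and by convexity the
   minimizer of E_k cannot lie outside the sphere. *)
Require Import Defs.
From mathcomp Require Import all_boot all_order all_algebra.
From mathcomp Require Import all_classical all_reals all_analysis.
From mathcomp Require Import measurable_realfun ring lra.

Set Implicit Arguments.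
Unset Strict Implicit.
Unset Printing Implicit Defensive.

Import Order.TTheory GRing.Theory Num.Theory.
Import numFieldNormedType.Exports.

Local Open Scope classical_set_scope.
Local Open Scope ring_scope.

(** * Euclidean inner product and norm *)

Definition dot (R : realType) (n : nat) (a b : 'rV[R]_n) : R :=
  \sum_(i < n) a ord0 i * b ord0 i.

Lemma dotC (R : realType) (n : nat) (a b : 'rV[R]_n) : dot a b = dot b a.
Proof. by apply: eq_bigr => i _; rewrite mulrC. Qed.

Lemma dotDl (R : realType) (n : nat) (a b c : 'rV[R]_n) :
  dot (a + b) c = dot a c + dot b c.
Proof. by rewrite -big_split; apply: eq_bigr => i _; rewrite mxE mulrDl. Qed.

Lemma dotZl (R : realType) (n : nat) (t : R) (a b : 'rV[R]_n) :
  dot (t *: a) b = t * dot a b.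
Proof. by rewrite mulr_sumr; apply: eq_bigr => i _; rewrite mxE mulrA. Qed.

Lemma dotNl (R : realType) (n : nat) (a b : 'rV[R]_n) : dot (- a) b = - dot a b.
Proof. by rewrite -scaleN1r dotZl mulN1r. Qed.

Lemma dotBl (R : realType) (n : nat) (a b c : 'rV[R]_n) :
  dot (a - b) c = dot a c - dot b c.
Proof. by rewrite dotDl dotNl. Qed.

Lemma dotBr (R : realType) (n : nat) (a b c : 'rV[R]_n) :
  dot c (a - b) = dot c a - dot c b.
Proof. by rewrite !(dotC c) dotBl. Qed.

Lemma dotZr (R : realType) (n : nat) (t : R) (a b : 'rV[R]_n) :
  dot b (t *: a) = t * dot b a.
Proof. by rewrite !(dotC b) dotZl. Qed.

Lemma dotNr (R : realType) (n : nat) (a b : 'rV[R]_n) : dot b (- a) = - dot b a.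
Proof. by rewrite !(dotC b) dotNl. Qed.

Lemma dot0l (R : realType) (n : nat) (a : 'rV[R]_n) : dot 0 a = 0.
Proof. by rewrite -(scale0r 0) dotZl mul0r. Qed.

Lemma dot_delta (R : realType) (n : nat) (a : 'rV[R]_n) (i : 'I_n) :
  dot a (delta_mx ord0 i) = a ord0 i.
Proof.
rewrite /dot (bigD1 i) //= big1 ?addr0 ?mxE ?eqxx ?mulr1 // => j ji.
by rewrite mxE (negPf ji) andbF mulr0.
Qed.

Lemma enorm_ge0 (R : realType) (n : nat) (a : 'rV[R]_n) : 0 <= enorm a.
Proof. exact: sqrtr_ge0. Qed.

Lemma enorm_sqr (R : realType) (n : nat) (a : 'rV[R]_n) :
  enorm a ^+ 2 = dot a a.
Proof.
rewrite sqr_sqrtr; last by apply: sumr_ge0 => i _; exact: sqr_ge0.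
by apply: eq_bigr => i _; rewrite expr2.
Qed.

Lemma normr_le_enorm (R : realType) (n : nat) (a : 'rV[R]_n) : `|a| <= enorm a.
Proof.
rewrite -[leLHS]/(mx_norm a) mx_normrE; apply: bigmax_le => [|[i j] _ /=].
  exact: enorm_ge0.
rewrite -sqrtr_sqr ler_wsqrtr// (ord1 i) (bigD1 j)//= lerDl.
by apply: sumr_ge0 => k _; exact: sqr_ge0.
Qed.

Lemma enorm_eq0 (R : realType) (n : nat) (a : 'rV[R]_n) :
  (enorm a == 0) = (a == 0).
Proof.
apply/eqP/eqP => [a0|->].
  by apply/eqP; rewrite -normr_le0 -a0 normr_le_enorm.
by apply/eqP; rewrite -sqrf_eq0 enorm_sqr dot0l.
Qed.

Lemma enorm_gt0 (R : realType) (n : nat) (a : 'rV[R]_n) :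
  (0 < enorm a) = (a != 0).
Proof. by rewrite lt0r enorm_ge0 enorm_eq0 andbT. Qed.

Lemma enorm0 (R : realType) (n : nat) : enorm (0 : 'rV[R]_n) = 0.
Proof. by apply/eqP; rewrite enorm_eq0. Qed.

Lemma enormZ (R : realType) (n : nat) (t : R) (a : 'rV[R]_n) :
  enorm (t *: a) = `|t| * enorm a.
Proof.
apply/eqP; rewrite -(eqrXn2 (n := 2)) ?mulr_ge0 ?enorm_ge0//.
by rewrite exprMn !enorm_sqr dotZl dotZr real_normK ?num_real// mulrA.
Qed.

Lemma enormN (R : realType) (n : nat) (a : 'rV[R]_n) : enorm (- a) = enorm a.
Proof. by rewrite -scaleN1r enormZ normrN1 mul1r. Qed.

(** Yields Cauchy-Schwarz, because the left side is nonnegative, and also its equality case, because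
    the last factor on the right then vanishes. *)
Lemma enorm_cross (R : realType) (n : nat) (a b : 'rV[R]_n) :
  enorm (enorm b *: a - enorm a *: b) ^+ 2 =
  2 * (enorm a * enorm b) * (enorm a * enorm b - dot a b).
Proof.
rewrite enorm_sqr !(dotBl, dotBr, dotZl, dotZr) (dotC b a) -!enorm_sqr; ring.
Qed.

Lemma dot_le_enorm (R : realType) (n : nat) (a b : 'rV[R]_n) :
  dot a b <= enorm a * enorm b.
Proof.
have [->|a0] := eqVneq a 0; first by rewrite dot0l enorm0 mul0r.
have [->|b0] := eqVneq b 0; first by rewrite dotC dot0l enorm0 mulr0.
have ab0 : 0 < 2 * (enorm a * enorm b) by rewrite !mulr_gt0 ?enorm_gt0.
by rewrite -subr_ge0 -(pmulr_rge0 _ ab0) -enorm_cross sqr_ge0.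
Qed.

Lemma dot_eq_enorm (R : realType) (n : nat) (a b : 'rV[R]_n) :
  dot a b = enorm a * enorm b -> enorm b *: a = enorm a *: b.
Proof.
move=> ab; apply/eqP; rewrite -subr_eq0 -enorm_eq0 -sqrf_eq0 enorm_cross ab.
by rewrite subrr mulr0.
Qed.

Lemma normr_dot_le (R : realType) (n : nat) (a b : 'rV[R]_n) :
  `|dot a b| <= enorm a * enorm b.
Proof.
by rewrite ler_norml dot_le_enorm andbT lerNl -dotNl -(enormN a) dot_le_enorm.
Qed.

Lemma enormD_le (R : realType) (n : nat) (a b : 'rV[R]_n) :
  enorm (a + b) <= enorm a + enorm b.
Proof.
rewrite -[leLHS]ger0_norm ?enorm_ge0// -[leRHS]ger0_norm ?addr_ge0 ?enorm_ge0//.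
rewrite -ler_sqr ?nnegrE// !real_normK ?num_real//.
rewrite enorm_sqr dotDl !(dotC _ (a + b)) !dotDl.
rewrite (dotC b a) -!enorm_sqr; have := dot_le_enorm a b; nra.
Qed.

Lemma ler_dist_enorm (R : realType) (n : nat) (a b : 'rV[R]_n) :
  `|enorm a - enorm b| <= enorm (a - b).
Proof.
have := enormD_le (a - b) b; have := enormD_le (b - a) a.
by rewrite !subrK -(enormN (b - a)) opprB ler_norml => ? ?; apply/andP; lra.
Qed.

Lemma enorm_continuous (R : realType) (n : nat) : continuous (@enorm R n).
Proof.
move=> x; apply: continuous_comp; last exact: sqrt_continuous.
apply: continuous_big => [|i _ y]; first exact: add_continuous.
apply: (@continuous_comp _ _ _ (fun z : 'rV[R]_n => z ord0 i)
  (fun t : R => t ^+ 2)).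
  exact: coord_continuous.
exact: exprn_continuous.
Qed.

Lemma dot_continuous (R : realType) (n : nat) (b : 'rV[R]_n) :
  continuous (fun a => dot a b).
Proof.
apply: continuous_big => [|i _ y]; first exact: add_continuous.
apply: continuousM; first exact: (@coord_continuous R 1 n ord0 i y).
exact: (@cst_continuous _ _ (b ord0 i)).
Qed.

(** * Primitives of the radial profile *)

(* Says that G is an antiderivative of a continuous g on the half-line; no other
   property of G is needed. *)
Definition mean_value_primitive (R : realType) (g G : R -> R) : Prop :=
  forall r s, 0 <= r -> r < s ->
    exists2 c, r < c < s & G s - G r = g c * (s - r).

Lemma primitive_mvt (R : realType) (f : R -> R) : continuous f ->
  exists G, mean_value_primitive f G.
Proof.
move=> fc.
have fi u : lebesgue_measure.-integrable `[-1, u] (EFin \o f).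
  apply: continuous_compact_integrable; first exact: segment_compact.
  exact: continuous_subspaceT.
(* Integration starts at -1, so that the derivative exists at 0 too. *)
exists (fun x => \int[lebesgue_measure]_(t in `[-1, x]) f t) => r s r0 rs.
have D (x : R) : -1 < x ->
    is_derive x 1 (fun x => \int[lebesgue_measure]_(t in `[-1, x]) f t) (f x).
  move=> x1; have [] :=
    @continuous_FTC1 _ f (BLeft (-1)) x (x + 1) _ (fi _) _ (fc x).
  - lra.
  - by rewrite lte_fin.
  - by move=> df eq; split => //; rewrite -derive1E.
have [x| |c] := @MVT R
    (fun x => \int[lebesgue_measure]_(t in `[-1, x]) f t) f r s rs.
- by rewrite in_itv/= => /andP[rx _]; apply: D; lra.
- apply: derivable_within_continuous => x; rewrite in_itv/= => /andP[rx _].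
  by have [] := D x ltac:(lra).
- by rewrite in_itv /= => cI E; exists c.
Qed.

(** * Bounded continuous functions and their integrals *)

Definition bcont (R : realType) (n : nat) (f : 'rV[R]_n -> R) : Prop :=
  continuous f /\ exists M, forall y, `|f y| <= M.

Lemma bcont_cst (R : realType) (n : nat) (c : R) :
  bcont (fun _ : 'rV[R]_n => c).
Proof. by split; [exact: cst_continuous|exists `|c|]. Qed.

Lemma bcontZ (R : realType) (n : nat) (c : R) (f : 'rV[R]_n -> R) :
  bcont f -> bcont (fun y => c * f y).
Proof.
move=> [fc [M fM]]; split=> [y|].
  apply: (@continuousM _ _ (fun _ : 'rV[R]_n => c) f); last exact: fc.
  exact: cst_continuous.
by exists (`|c| * M) => y; rewrite normrM ler_wpM2l.
Qed.

Lemma bcontB (R : realType) (n : nat) (f h : 'rV[R]_n -> R) :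
  bcont f -> bcont h -> bcont (fun y => f y - h y).
Proof.
move=> [fc [M fM]] [hc [N hN]]; split=> [y|].
  exact: (@continuousB _ _ _ f h y (fc y) (hc y)).
by exists (M + N) => y; apply: le_trans (ler_normB _ _) _; apply: lerD.
Qed.

Lemma continuous_measurable_rV (R : realType) (n : nat) (f : 'rV[R]_n -> R) :
  continuous f -> measurable_fun [set: borel_rV R n] f.
Proof.
move=> /continuousP fc.
apply: (measurability _ (RGenOpens.measurableE R)) => _ [_ [a [b ->]] <-].
rewrite setTI; apply: sub_sigma_algebra; apply: fc; exact: interval_open.
Qed.

Section bcont_integral.
Variables (R : realType) (n : nat).
Variable mu : {measure set (borel_rV R n) -> \bar R}.
Hypothesis mu_fin : (mu [set: 'rV[R]_n] < +oo)%E.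

Lemma bcont_integrable (f : 'rV[R]_n -> R) :
  bcont f -> mu.-integrable setT (EFin \o f).
Proof.
move=> [fc [M fM]]; apply: measurable_bounded_integrable => //.
  exact: continuous_measurable_rV.
exists M; split; first exact: num_real.
by move=> N MN x _ /=; apply: le_trans (fM x) _; exact: ltW.
Qed.

(** If the integral were zero, [f] would vanish almost everywhere and [A] would lie in a null
    set. *)
Lemma Rintegral_gt0 (f : 'rV[R]_n -> R) (A : set 'rV[R]_n) :
  bcont f -> (forall y, 0 <= f y) -> measurable (A : set (borel_rV R n)) ->
  (0 < mu A)%E -> (forall y, A y -> 0 < f y) -> 0 < \int[mu]_y f y.
Proof.
move=> fb f0 mA muA fA.
rewrite lt_neqAle Rintegral_ge0 ?andbT//; apply/eqP => /esym int0.
have int0E : (\int[mu]_y `|(f y)%:E| = 0)%E.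
  under eq_integral do rewrite abse_EFin ger0_norm//.
  rewrite -[LHS]fineK; first by rewrite -[fine _]/(\int[mu]_y f y) int0.
  exact: integrable_fin_num (bcont_integrable fb).
have mf : measurable_fun [set: borel_rV R n]
    (EFin \o (f : borel_rV R n -> R)).
  by apply/measurable_EFinP; apply: continuous_measurable_rV; case: fb.
have /(ae_eq_integral_abs mu measurableT mf) := int0E.
move=> [N [mN muN sN]].
have : (mu A <= mu N)%E.
  apply: le_measure; rewrite ?inE// => y Ay; apply: sN => /(_ I) [fy].
  by have := fA y Ay; rewrite fy ltxx.
by rewrite muN leNgt muA.
Qed.

(** Dominated convergence: the constant [M] is an integrable bound because [mu] is finite. *)
Lemma bcont_cvg_Rintegral (f_ : nat -> 'rV[R]_n -> R) (f : 'rV[R]_n -> R)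
    (M : R) :
  (forall k, continuous (f_ k)) -> bcont f ->
  (forall k y, `|f_ k y| <= M) ->
  (forall y, f_ k y @[k --> \oo] --> f y) ->
  \int[mu]_y f_ k y @[k --> \oo] --> \int[mu]_y f y.
Proof.
move=> f_c fb fM cvgf.
have iM : mu.-integrable setT (EFin \o cst M).
  by apply: bcont_integrable; split; [exact: cst_continuous|exists `|M|].
have fi := bcont_integrable fb.
apply: fine_cvg; rewrite fineK ?integrable_fin_num//.
apply: (@dominated_cvg _ _ _ mu setT measurableT (fun k y => (f_ k y)%:E)
  (EFin \o f) (EFin \o cst M)) => //.
- by move=> k; apply/measurable_EFinP; exact: continuous_measurable_rV.
- by move=> y _; apply: cvg_EFin; [near=> k|exact: cvgf].
- by move=> k y _; rewrite lee_fin.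
Unshelve. all: end_near. Qed.

End bcont_integral.

(** * The vector field v *)

Lemma dot_vfield (R : realType) (n : nat) (g : R -> R) (y h : 'rV[R]_n) :
  dot (vfield g y) h = g (enorm y) * ((enorm y)^-1 * dot y h).
Proof.
rewrite /vfield; case: eqP => [->|_]; first by rewrite !dot0l !mulr0.
by rewrite !dotZl.
Qed.

Lemma normr_dot_vfield_le (R : realType) (n : nat) (g : R -> R)
  (y h : 'rV[R]_n) : `|dot (vfield g y) h| <= `|g (enorm y)| * enorm h.
Proof.
rewrite dot_vfield normrM ler_wpM2l// normrM normfV (ger0_norm (enorm_ge0 y)).
have [->|y0] := eqVneq y 0; first by rewrite dot0l normr0 mulr0 enorm_ge0.
by rewrite ler_pdivrMl ?enorm_gt0// normr_dot_le.
Qed.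

Lemma normr_le_cvg0 (R : realType) (T : Type) (F : set_system T)
    (FF : Filter F) (f h : T -> R) : (forall x, `|f x| <= h x) ->
  h x @[x --> F] --> 0 -> f x @[x --> F] --> 0.
Proof.
move=> fh h0; apply/norm_cvg0P; apply: squeeze_cvgr (cvg_cst 0) h0.
by apply: nearW => x; rewrite normr_ge0 fh.
Qed.

Lemma dist_le_continuous (R : realType) (T : topologicalType) (f h : T -> R)
    (a : T) : (forall x, `|f x - f a| <= h x) -> h a = 0 ->
  {for a, continuous h} -> {for a, continuous f}.
Proof.
move=> fh ha hc; apply/subr_cvg0; apply: normr_le_cvg0 fh _.
by move: hc; rewrite /prop_for /continuous_at ha.
Qed.

Lemma enorm_sub_continuous (R : realType) (n : nat) (M : R) (a : 'rV[R]_n) :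
  continuous (fun b : 'rV[R]_n => M * enorm (b - a)).
Proof.
move=> b; apply: (@continuousM _ _ (cst M)
  (fun b : 'rV[R]_n => enorm (b - a))).
  exact: cst_continuous.
apply: continuous_comp; last exact: enorm_continuous.
by apply: continuousB; [exact|exact: cst_continuous].
Qed.

(** Only the origin is delicate: the direction of [y] has no limit to offer there, but the length of
    the field tends to 0 because [g 0 = 0]. *)
Lemma dot_vfield_continuous (R : realType) (n : nat) (g : R -> R)
    (h : 'rV[R]_n) : continuous (fun r : R => g `|r|) -> g 0 = 0 ->
  continuous (fun y => dot (vfield g y) h).
Proof.
move=> gc g0 y.
have genormc : continuous (fun y : 'rV[R]_n => g (enorm y)).
  move=> z; have -> : (fun y : 'rV[R]_n => g (enorm y)) =
      (fun r : R => g `|r|) \o @enorm R n.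
    by apply/funext => w /=; rewrite ger0_norm ?enorm_ge0.
  by apply: continuous_comp; [exact: enorm_continuous|exact: gc].
have [->|y0] := eqVneq y 0.
  rewrite /continuous_at {2}/vfield eqxx dot0l.
  apply: (@normr_le_cvg0 R _ (nbhs (0 : 'rV[R]_n)) _ _
    (fun y => `|g (enorm y)| * enorm h)) => [z|].
    exact: normr_dot_vfield_le.
  have -> : 0 = `|g (enorm (0 : 'rV[R]_n))| * enorm h.
    by rewrite enorm0 g0 normr0 mul0r.
  apply: (@continuousM _ _ (fun y : 'rV[R]_n => `|g (enorm y)|)
    (cst (enorm h))).
    by apply: continuous_comp; [exact: genormc|exact: norm_continuous].
  exact: cst_continuous.
rewrite (_ : (fun y => _) =
    (fun y : 'rV[R]_n => g (enorm y) * ((enorm y)^-1 * dot y h))); last first.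
  by apply/funext => z; rewrite dot_vfield.
apply: (@continuousM _ _ (fun y : 'rV[R]_n => g (enorm y))
  (fun y : 'rV[R]_n => (enorm y)^-1 * dot y h)); first exact: genormc.
apply: (@continuousM _ _ (fun y : 'rV[R]_n => (enorm y)^-1)
  (fun y => dot y h)); last exact: dot_continuous.
by apply: continuousV; rewrite ?enorm_eq0//; exact: enorm_continuous.
Qed.

(** * The radial potential G(|x|) and its derivative *)

Section potential.
Variables (R : realType) (n : nat) (g G : R -> R).
Hypothesis gG : mean_value_primitive g G.
Implicit Types a b z h : 'rV[R]_n.

(** Frees the mean value property of the order of [r] and [s]; the bound on [r - c] makes [c] tend
    to [r] when [s] does. *)
Lemma mean_value_point (r s : R) : 0 <= r -> 0 <= s ->
  exists c, [/\ 0 <= c, `|r - c| <= `|r - s| & G s - G r = g c * (s - r)].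
Proof.
move=> r0 s0; have [rs|sr|->] := ltgtP r s.
- have [c cI E] := gG r0 rs; exists c; split => //; first lra.
  by rewrite distrC (distrC r) !ger0_norm; lra.
- have [c cI E] := gG s0 sr; exists c; split => //; first lra.
    by rewrite !ger0_norm; lra.
  by rewrite -opprB E -mulrN opprB.
- by exists s; split => //; rewrite ?subrr ?mulr0.
Qed.

Lemma potential_lipschitz (M : R) a b :
  (forall r, 0 <= r -> `|g r| <= M) ->
  `|G (enorm a) - G (enorm b)| <= M * enorm (a - b).
Proof.
move=> gM; have [c [c0 _ ->]] := mean_value_point (enorm_ge0 b) (enorm_ge0 a).
by rewrite normrM ler_pM ?normr_ge0 ?gM ?ler_dist_enorm.
Qed.

Lemma potential_continuous (M : R) : (forall r, 0 <= r -> `|g r| <= M) ->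
  continuous (fun a => G (enorm a)).
Proof.
move=> gM a; apply: (dist_le_continuous (h := fun b => M * enorm (b - a))).
- by move=> b; exact: potential_lipschitz.
- by rewrite subrr enorm0 mulr0.
- exact: enorm_sub_continuous.
Qed.

(** The mean value property splits the quotient into [g (c k)] times the difference quotient of the
    norm. The step runs through a sequence so that dominated convergence can be applied later. *)
Lemma potential_deriv_cvg a h : continuous (fun r : R => g `|r|) -> g 0 = 0 ->
  k.+1%:R * (G (enorm (a + k.+1%:R^-1 *: h)) - G (enorm a)) @[k --> \oo]
    --> dot (vfield g a) h.
Proof.
move=> gc g0; pose t k : R := k.+1%:R^-1.
have t0 k : 0 < t k by rewrite invr_gt0.
have tcvg : t k @[k --> \oo] --> (0 : R) by exact: cvg_harmonic.
have /choice[c cP] : forall k, exists c, [/\ 0 <= c,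
    `|enorm a - c| <= t k * enorm h &
    G (enorm (a + t k *: h)) - G (enorm a) =
      g c * (enorm (a + t k *: h) - enorm a)].
  move=> k; have [c [c0 cb E]] :=
    mean_value_point (enorm_ge0 a) (enorm_ge0 (a + t k *: h)).
  exists c; split => //; apply: le_trans cb _.
  apply: le_trans (ler_dist_enorm _ _) _.
  by rewrite opprD addNKr enormN enormZ gtr0_norm.
have ccvg : c k @[k --> \oo] --> enorm a.
  apply/cvgrPdist_le.
  have : t k * enorm h @[k --> \oo] --> (0 : R).
    rewrite -(mul0r (enorm h)); exact: (cvgM tcvg (cvg_cst (enorm h))).
  move=> /cvgrPdist_le H e e0; apply: filterS (H e e0) => k /=.
  rewrite sub0r normrN => H'; apply: le_trans H'.
  by have [_ ? _] := cP k; apply: le_trans (ler_norm _).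
have gcvg : g (c k) @[k --> \oo] --> g (enorm a).
  have -> : (fun k => g (c k)) = (fun k => g `|c k|).
    by apply/funext => k; have [? _ _] := cP k; rewrite ger0_norm.
  rewrite -[enorm a]ger0_norm ?enorm_ge0//.
  exact: (continuous_cvg _ (gc (enorm a)) ccvg).
pose w k := (t k)^-1 * (enorm (a + t k *: h) - enorm a).
have -> : (fun k => k.+1%:R * (G (enorm (a + k.+1%:R^-1 *: h)) - G (enorm a)))
          = (fun k => g (c k) * w k).
  apply/funext => k; have [_ _] := cP k; rewrite -/(t k) => ->.
  by rewrite /w invrK mulrCA.
(* At the origin the quotient of the norm is constantly [enorm h], and the factor [g (c k)] brings
   the limit down to 0. *)
have [a0|a0] := eqVneq a 0.
  have -> : dot (vfield g a) h = g (enorm a) * enorm h.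
    by rewrite a0 /vfield eqxx dot0l enorm0 g0 mul0r.
  apply: cvgM => //.
  rewrite (_ : w = cst (enorm h)); first exact: cvg_cst.
  apply/funext => k.
  rewrite /w a0 add0r enorm0 subr0 enormZ gtr0_norm// mulKf//.
  by rewrite gt_eqF.
rewrite dot_vfield; apply: cvgM => //.
(* Rationalization: the difference of the squared norms is computable, and the sum of the norms
   stays away from 0. *)
have wE k : w k = (enorm (a + t k *: h) + enorm a)^-1 *
    (2 * dot a h + t k * enorm h ^+ 2).
  have a1 := enorm_ge0 (a + t k *: h).
  have a2 : 0 < enorm a by rewrite enorm_gt0.
  have a3 := enorm_sqr (a + t k *: h).
  rewrite dotDl !(dotC _ (a + _)) !dotDl dotZl !dotZr dotZl in a3.
  rewrite (dotC h a) -!enorm_sqr in a3.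
  rewrite /w; apply: (mulfI (lt0r_neq0 (t0 k))).
  rewrite mulVKf; last by rewrite gt_eqF.
  apply: (@mulfI _ (enorm (a + t k *: h) + enorm a)).
    by rewrite gt_eqF; lra.
  rewrite [RHS]mulrCA mulVKf; last by rewrite gt_eqF; lra.
  rewrite mulrC -subr_sqr a3; ring.
rewrite (funext wE).
have -> : (enorm a)^-1 * dot a h =
    (enorm a + enorm a)^-1 * (2 * dot a h + 0 * enorm h ^+ 2).
  by field; rewrite -mulr2n mulrn_eq0 enorm_eq0 a0.
apply: cvgM.
  apply: cvgV; first by rewrite gt_eqF// addr_gt0 ?enorm_gt0.
  apply: cvgD; last exact: cvg_cst.
  rewrite -[X in enorm X](addr0 a) -(scale0r h).
  apply: (continuous_cvg _ (@enorm_continuous R n _)).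
  apply: cvgD; first exact: cvg_cst.
  apply: cvgZl tcvg.
by apply: cvgD; [exact: cvg_cst|exact: (cvgM tcvg (cvg_cst _))].
Qed.

End potential.

(** * The subgradient inequality for the potential and its equality case *)

Section subgradient.
Variables (R : realType) (n : nat) (g G : R -> R).
Hypothesis gG : mean_value_primitive g G.
Hypothesis g0 : g 0 = 0.
Hypothesis g_ndecr : {in `[0, +oo[ &, {homo g : r s / r <= s}}.
Implicit Types a b : 'rV[R]_n.

Lemma profile_le r s : 0 <= r -> r <= s -> g r <= g s.
Proof. by move=> r0 rs; apply: g_ndecr; rewrite ?in_itv/= ?andbT//; lra. Qed.

Lemma primitive_subgradient r s : 0 <= r -> 0 <= s ->
  g r * (s - r) <= G s - G r.
Proof.
move=> r0 s0; have [rs|sr|->] := ltgtP r s; last by rewrite !subrr mulr0.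
- have [c cI ->] := gG r0 rs; rewrite ler_pM2r ?subr_gt0//.
  by apply: profile_le => //; lra.
- have [c cI E] := gG s0 sr; rewrite -opprB -[leRHS]opprB E mulrN lerN2.
  by rewrite ler_pM2r ?subr_gt0//; apply: profile_le; lra.
Qed.

(** Cauchy-Schwarz, multiplied by [g (enorm a)], which is nonnegative since [g] increases from 0. *)
Lemma dot_vfieldB_le a b :
  dot (vfield g a) (b - a) <= g (enorm a) * (enorm b - enorm a).
Proof.
rewrite dot_vfield.
have [->|a0] := eqVneq a 0; first by rewrite dot0l enorm0 g0 !mul0r.
rewrite ler_wpM2l//; first by rewrite -g0 profile_le ?enorm_ge0.
rewrite ler_pdivrMl ?enorm_gt0// dotBr -enorm_sqr mulrBr -expr2.
by rewrite lerD2r dot_le_enorm.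
Qed.

Lemma potential_subgradient a b :
  dot (vfield g a) (b - a) <= G (enorm b) - G (enorm a).
Proof.
apply: le_trans (dot_vfieldB_le a b) _.
by rewrite primitive_subgradient ?enorm_ge0.
Qed.

(** The inequality is a chain through [g (enorm a) * (enorm b - enorm a)]. Equality at its ends
    forces equality in the Cauchy-Schwarz link, where the positive [g (enorm a)] cancels. *)
Lemma potential_subgradient_eq a b : (forall r, 0 < r -> 0 < g r) ->
  dot (vfield g a) (b - a) = G (enorm b) - G (enorm a) ->
  enorm b *: a = enorm a *: b.
Proof.
move=> gpos ab; have [->|a0] := eqVneq a 0.
  by rewrite enorm0 scaler0 scale0r.
have ga : 0 < g (enorm a) by rewrite gpos ?enorm_gt0.
have := dot_vfieldB_le a b.
have := primitive_subgradient (enorm_ge0 a) (enorm_ge0 b).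
rewrite -ab => h1 h2.
have /eqP : dot (vfield g a) (b - a) = g (enorm a) * (enorm b - enorm a).
  by apply/eqP; rewrite eq_le h1 h2.
rewrite dot_vfield dotBr -enorm_sqr -subr_eq0 -mulrBr mulf_eq0 gt_eqF//=.
move=> /eqP h3.
apply: dot_eq_enorm; have a1 : enorm a != 0 by rewrite enorm_eq0.
move/(congr1 (fun x => enorm a * x)): h3; rewrite mulr0 mulrBr mulVKf//; nra.
Qed.

End subgradient.

(** With [g] strictly increasing, the radial link of the chain is strict unless the norms agree;
    vectors of equal norm and direction coincide. *)
Lemma potential_strict_subgradient (R : realType) (n : nat) (g G : R -> R)
    (a b : 'rV[R]_n) : mean_value_primitive g G -> g 0 = 0 ->
    {in `[0, +oo[ &, {homo g : r s / r < s}} ->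
  dot (vfield g a) (b - a) = G (enorm b) - G (enorm a) -> a = b.
Proof.
move=> gG g0 g_incr ab.
have g_ndecr : {in `[0, +oo[ &, {homo g : r s / r <= s}} by exact: ltW_homo_in.
have gpos r : 0 < r -> 0 < g r.
  by move=> r0; rewrite -g0; apply: g_incr; rewrite ?in_itv/= ?lexx ?ltW.
have Eab : enorm a = enorm b.
  move: (dot_vfieldB_le g0 g_ndecr a b); rewrite ab.
  have [rs|sr|//] := ltgtP (enorm a) (enorm b).
  - have [c cI ->] := gG _ _ (enorm_ge0 a) rs; rewrite ler_pM2r ?subr_gt0//.
    by rewrite leNgt g_incr// ?in_itv/= ?andbT; have := enorm_ge0 a; lra.
  - have [c cI E] := gG _ _ (enorm_ge0 b) sr.
    rewrite -[leLHS]opprB E -[enorm b - _]opprB mulrN lerN2.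
    rewrite ler_pM2r ?subr_gt0//.
    by rewrite leNgt g_incr// ?in_itv/= ?andbT; have := enorm_ge0 b; lra.
have := potential_subgradient_eq gG g0 g_ndecr gpos ab.
have [b0 _|b0] := eqVneq (enorm b) 0.
  have /eqP -> : a == 0 by rewrite -enorm_eq0 Eab b0.
  by apply/esym/eqP; rewrite -enorm_eq0 b0.
by rewrite Eab => /(scalerI b0).
Qed.

(** * The energy and its critical points *)

Lemma Rintegral_sum_bcont (R : realType) (n : nat)
    (mu : {measure set (borel_rV R n) -> \bar R})
    (mu_fin : (mu [set: 'rV[R]_n] < +oo)%E) (I : Type) (s : seq I)
    (f : I -> 'rV[R]_n -> R) : (forall i, bcont (f i)) ->
  \int[mu]_y (\sum_(i <- s) f i y) = \sum_(i <- s) \int[mu]_y f i y.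
Proof.
move=> fb; elim: s => [|i s IH].
  under eq_Rintegral do rewrite big_nil.
  by rewrite Rintegral_cst// mul0r big_nil.
have sb : bcont (fun y => \sum_(j <- s) f j y).
  split.
    by apply: continuous_big => [|j _]; [exact: add_continuous|case: (fb j)].
  have /choice[N fN] : forall j, exists N, forall y, `|f j y| <= N.
    by move=> j; case: (fb j).
  exists (\sum_(j <- s) N j) => y.
  by apply: le_trans (ler_norm_sum _ _ _) _; apply: ler_sum.
under eq_Rintegral do rewrite big_cons.
by rewrite RintegralD ?big_cons ?IH//; exact: bcont_integrable.
Qed.

(** Subtracting [G (enorm y)] keeps the integrand bounded in [y] when [g] is bounded, so that every
    finite measure has a finite energy. *)
Definition energy (R : realType) (n : nat) (G : R -> R)
    (mu : {measure set (borel_rV R n) -> \bar R}) (x : 'rV[R]_n) : R :=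
  \int[mu]_y (G (enorm (x + y)) - G (enorm y)).

Section energy.
Variables (R : realType) (n : nat) (g G : R -> R) (M : R).
Variable mu : {measure set (borel_rV R n) -> \bar R}.
Hypothesis mu_fin : (mu [set: 'rV[R]_n] < +oo)%E.
Hypothesis g_cont : continuous (fun r : R => g `|r|).
Hypothesis g0 : g 0 = 0.
Hypothesis gM : forall r, 0 <= r -> `|g r| <= M.
Hypothesis gG : mean_value_primitive g G.
Implicit Types x z h : 'rV[R]_n.

Lemma addl_continuous (x : 'rV[R]_n) : continuous (fun y : 'rV[R]_n => x + y).
Proof. by move=> y; apply: continuousD; [exact: cst_continuous|exact]. Qed.

Lemma bcont_potentialB x z :
  bcont (fun y => G (enorm (x + y)) - G (enorm (z + y))).
Proof.
have Fc u : continuous (fun y : 'rV[R]_n => G (enorm (u + y))).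
  move=> y; apply: (@continuous_comp _ _ _ (fun y : 'rV[R]_n => u + y)
    (fun w : 'rV[R]_n => G (enorm w))); first exact: addl_continuous.
  exact: (potential_continuous gG gM).
split=> [y|]; first exact: (@continuousB _ _ _ _ _ _ (Fc x y) (Fc z y)).
exists (M * enorm (x - z)) => y.
have := potential_lipschitz gG (x + y) (z + y) gM.
by rewrite opprD addrACA subrr addr0.
Qed.

Lemma bcont_energy x : bcont (fun y => G (enorm (x + y)) - G (enorm y)).
Proof. by have := bcont_potentialB x 0; under eq_fun do rewrite add0r. Qed.

Lemma bcont_dot_vfield x h : bcont (fun y => dot (vfield g (x + y)) h).
Proof.
split=> [y|].
  apply: (@continuous_comp _ _ _ (fun y : 'rV[R]_n => x + y)
    (fun w => dot (vfield g w) h)); first exact: addl_continuous.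
  exact: dot_vfield_continuous.
exists (M * enorm h) => y; apply: le_trans (normr_dot_vfield_le _ _ _) _.
by rewrite ler_wpM2r ?enorm_ge0// gM ?enorm_ge0.
Qed.

Lemma energyB x z : energy G mu x - energy G mu z =
  \int[mu]_y (G (enorm (x + y)) - G (enorm (z + y))).
Proof.
rewrite -RintegralB//; try by apply: bcont_integrable; [|exact: bcont_energy].
by apply: eq_Rintegral => y _; rewrite opprB addrA subrK.
Qed.

Lemma energy_lipschitz x z : `|energy G mu x - energy G mu z|
  <= M * enorm (x - z) * fine (mu setT).
Proof.
rewrite energyB; have bP := bcont_potentialB x z.
apply: le_trans (le_normr_Rintegral _ (bcont_integrable mu_fin bP)) _ => //.
rewrite -Rintegral_cst//; apply: le_Rintegral => //.
- have := bcont_integrable mu_fin bP. exact: integrable_norm.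
- apply: (@bcont_integrable _ _ _ mu_fin (cst (M * enorm (x - z)))).
  by split; [exact: cst_continuous|exists `|M * enorm (x - z)|].
move=> y _; have := potential_lipschitz gG (x + y) (z + y) gM.
by rewrite opprD addrACA subrr addr0.
Qed.

Lemma energy_continuous : continuous (energy G mu).
Proof.
move=> x; apply: (dist_le_continuous
  (h := fun z => M * fine (mu setT) * enorm (z - x))).
- by move=> z; rewrite mulrAC energy_lipschitz.
- by rewrite subrr enorm0 mulr0.
- exact: enorm_sub_continuous.
Qed.

Lemma dot_Vfield x h :
  dot (Vfield g mu x) h = \int[mu]_y dot (vfield g (x + y)) h.
Proof.
rewrite Rintegral_sum_bcont => [|//|i].
  apply: eq_bigr => i _; rewrite mxE RintegralZr//.
  apply: bcont_integrable => //.
  have := bcont_dot_vfield x (delta_mx ord0 i).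
  by under eq_fun do rewrite dot_delta.
have := bcont_dot_vfield x (h ord0 i *: delta_mx ord0 i).
by under eq_fun do rewrite dotZr dot_delta mulrC.
Qed.

(** At a minimizer the difference quotients are nonnegative, and [M * enorm h] dominates them, so
    the sign passes to the limit [dot (Vfield g mu x) h]. Using [h] and [- h] gives 0. *)
Lemma Vfield_eq0_of_min x : (forall z, energy G mu x <= energy G mu z) ->
  Vfield g mu x = 0.
Proof.
move=> xmin.
have ge0 h : 0 <= dot (Vfield g mu x) h.
  rewrite dot_Vfield.
  pose q k (y : 'rV[R]_n) := k.+1%:R *
    (G (enorm (x + y + k.+1%:R^-1 *: h)) - G (enorm (x + y))).
  have qb k : bcont (fun y =>
      G (enorm (x + k.+1%:R^-1 *: h + y)) - G (enorm (x + y))).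
    exact: bcont_potentialB.
  have qE k : q k = (fun y => k.+1%:R *
      (G (enorm (x + k.+1%:R^-1 *: h + y)) - G (enorm (x + y)))).
    by apply/funext => y; rewrite /q addrAC.
  have : \int[mu]_y q k y @[k --> \oo] --> \int[mu]_y dot (vfield g (x + y)) h.
    apply: (bcont_cvg_Rintegral mu_fin (M := M * enorm h)).
    - by move=> k; rewrite qE; case: (bcontZ k.+1%:R (qb k)).
    - exact: bcont_dot_vfield.
    - move=> k y; rewrite /q normrM gtr0_norm//.
      rewrite -ler_pdivlMl//; apply: le_trans (potential_lipschitz gG _ _ gM) _.
      by rewrite addrC addKr enormZ gtr0_norm ?invr_gt0// mulrCA.
    - by move=> y; exact: potential_deriv_cvg.
  move=> /cvgr_to_ge; apply; apply: nearW => k.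
  rewrite qE RintegralZl//; last exact: bcont_integrable.
  by rewrite mulr_ge0// -energyB subr_ge0.
apply/rowP => i; rewrite [RHS]mxE -dot_delta; apply/eqP.
by rewrite eq_le ge0 andbT -oppr_ge0 -dotNr.
Qed.

End energy.

(** * Coercivity and existence of a minimizer *)

Section coercivity.
Variables (R : realType) (n : nat) (g G : R -> R) (M m r0 : R).
Variable mu : {measure set (borel_rV R n) -> \bar R}.
Hypothesis mu_gt0 : (0 < mu [set: 'rV[R]_n])%E.
Hypothesis mu_fin : (mu [set: 'rV[R]_n] < +oo)%E.
Hypothesis gM : forall r, 0 <= r -> `|g r| <= M.
Hypothesis gG : mean_value_primitive g G.
Hypothesis m_gt0 : 0 < m.
Hypothesis r0_ge0 : 0 <= r0.
Hypothesis g_ge : forall r, r0 <= r -> m <= g r.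
Implicit Types x y : 'rV[R]_n.

(** Up to [r0] the primitive falls at rate at most [M]; beyond it, it grows at rate at least [m]. *)
Lemma primitive_lower s : 0 <= s -> m * s - (M + m) * r0 <= G s - G 0.
Proof.
move=> s0; have M0 : 0 <= M by exact: le_trans (normr_ge0 _) (gM (lexx 0)).
have lip r : 0 <= r -> - (M * r) <= G r - G 0.
  move=> r_ge0; have [c [c0 _ ->]] := mean_value_point gG (lexx 0) r_ge0.
  by have := gM c0; rewrite subr0 ler_norml => /andP[? _]; nra.
have [sr|rs] := leP s r0.
  have : (M + m) * s <= (M + m) * r0 by rewrite ler_wpM2l// addr_ge0// ltW.
  have := lip _ s0; lra.
have [c cI E] := gG r0_ge0 rs.
have := lip _ r0_ge0; have : m <= g c by apply: g_ge; lra.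
have -> : G s - G 0 = g c * (s - r0) + (G r0 - G 0) by rewrite -E; ring.
move=> mgc lip0; have : m * (s - r0) <= g c * (s - r0).
  by rewrite ler_wpM2r//; lra.
lra.
Qed.

(** The left side is [m * enorm x - (M + m) * (enorm y + r0)], arranged so that factoring out
    [enorm x] leads to the cutoff. *)
Lemma potential_coercive x y :
  (M + m) * (enorm x - (enorm y + r0)) - M * enorm x
    <= G (enorm (x + y)) - G (enorm y).
Proof.
have h1 := primitive_lower (enorm_ge0 (x + y)).
have h2 : enorm x - enorm y <= enorm (x + y).
  by have := enormD_le (x + y) (- y); rewrite addrK enormN; lra.
have [c [c0 _ E]] := mean_value_point gG (lexx 0) (enorm_ge0 y).
have h3 : G (enorm y) - G 0 <= M * enorm y.
  rewrite E subr0 ler_wpM2r ?enorm_ge0//.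
  by have := gM c0; rewrite ler_norml => /andP[].
have h4 : m * (enorm x - enorm y) <= m * enorm (x + y) by rewrite ler_pM2l.
lra.
Qed.

(* For |x| >= k+1 the integrand of the energy is at least
   |x| ((M + m) cutoff k y - M), and cutoff k increases to 1 with k. *)
Definition cutoff k y : R := Num.max 0 (1 - k.+1%:R^-1 * (enorm y + r0)).

Lemma bcont_cutoff k : bcont (cutoff k).
Proof.
split=> [y|]; last first.
  exists 1 => y; rewrite ger0_norm ?le_max ?lexx// ge_max ler01/=.
  by rewrite lerBlDr lerDl mulr_ge0// addr_ge0 ?enorm_ge0.
apply: (@continuous_max _ _ (cst 0)
  (fun y : 'rV[R]_n => 1 - k.+1%:R^-1 * (enorm y + r0)));
  first exact: cst_continuous.
apply: continuousB; first exact: cst_continuous.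
apply: (@continuousM _ _ (cst (k.+1%:R^-1 : R))
  (fun y : 'rV[R]_n => enorm y + r0)); first exact: cst_continuous.
apply: (@continuousD _ _ _ (@enorm R n) (cst r0)); last exact: cst_continuous.
exact: enorm_continuous.
Qed.

Lemma cutoff_cvg y : cutoff k y @[k --> \oo] --> (1 : R).
Proof.
have c1 : 1 - k.+1%:R^-1 * (enorm y + r0) @[k --> \oo] --> (1 : R).
  rewrite -[X in _ --> X]subr0 -(mul0r (enorm y + r0)).
  apply: cvgB; first exact: cvg_cst.
  by apply: cvgM; [exact: cvg_harmonic|exact: cvg_cst].
rewrite (_ : (1 : R) = Num.max 0 1); last by apply/esym/max_idPr.
have mc : continuous (fun t : R => Num.max 0 t).
  move=> t; apply: (@continuous_max _ _ (cst 0) id); last exact.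
  exact: cst_continuous.
exact: (continuous_cvg _ (mc 1) c1).
Qed.

(** Mass far from the origin may contribute as little as [- M * enorm x], but it is a small part:
    the integral of [cutoff k] tends to the total mass [W], so the lower bound for E(x)/|x| tends to
    [m * W]. *)
Lemma energy_coercive :
  exists k : nat, forall x, k.+1%:R <= enorm x -> 0 < energy G mu x.
Proof.
have M0 : 0 <= M by exact: le_trans (normr_ge0 _) (gM (lexx 0)).
set W := fine (mu setT).
have W0 : 0 < W by rewrite fine_gt0// mu_gt0.
have cvgW : \int[mu]_y cutoff k y @[k --> \oo] --> W.
  rewrite -[W]mul1r -Rintegral_cst//.
  apply: (bcont_cvg_Rintegral mu_fin (M := 1)).
  - by move=> k; case: (bcont_cutoff k).
  - exact: bcont_cst.
  - move=> k y; rewrite ger0_norm ?le_max ?lexx// ge_max ler01/=.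
    by rewrite lerBlDr lerDl mulr_ge0// addr_ge0 ?enorm_ge0.
  - exact: cutoff_cvg.
have Mm : 0 < M + m by rewrite ltr_wpDl.
(* The threshold is where the lower bound changes sign; it is below [W] as [M < M + m]. *)
have [k _ Hk] : \forall k \near \oo, M * W / (M + m) < \int[mu]_y cutoff k y.
  apply: (cvgr_gt W cvgW); by rewrite ltr_pdivrMr// mulrC ltr_pM2l// ltrDl.
have {}Hk := Hk k (leqnn k); rewrite ltr_pdivrMr// in Hk.
exists k => x kx; have x0 : 0 < enorm x by apply: lt_le_trans kx.
have key y : (M + m) * enorm x * cutoff k y - M * enorm x <=
    G (enorm (x + y)) - G (enorm y).
  (* On the affine branch of the cutoff, [enorm x / k.+1%:R] is at least 1 and the coercive bound
     suffices; on the zero branch, the Lipschitz bound does. *)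
  rewrite /cutoff; case: (leP 0 (1 - _)) => _.
    apply: le_trans (potential_coercive x y).
    rewrite lerD2r -mulrA ler_pM2l// mulrBr mulr1 lerD2l lerN2.
    rewrite mulrA ler_peMl ?addr_ge0 ?enorm_ge0//.
    by rewrite ler_pdivlMr ?mul1r.
  rewrite mulr0 sub0r.
  have := potential_lipschitz gG (x + y) y gM.
  by rewrite addrK ler_norml => /andP[].
have xb : bcont (fun y => (M + m) * enorm x * cutoff k y - M * enorm x).
  by apply: bcontB; [exact: bcontZ (bcont_cutoff k)|exact: bcont_cst].
have : \int[mu]_y ((M + m) * enorm x * cutoff k y - M * enorm x) <=
    energy G mu x.
  apply: le_Rintegral => //; apply: bcont_integrable => //.
  exact: bcont_energy gM gG x.
apply: lt_le_trans; rewrite RintegralB//; last 2 first.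
- by apply: bcont_integrable => //; exact: bcontZ (bcont_cutoff k).
- by apply: bcont_integrable => //; exact: bcont_cst.
rewrite RintegralZl//; last exact: bcont_integrable (bcont_cutoff k).
rewrite Rintegral_cst// -/W subr_gt0 mulrAC [ltRHS]mulrAC ltr_pM2r//.
by rewrite [ltRHS]mulrC.
Qed.

Lemma energy_minimizer : exists x, forall z, energy G mu x <= energy G mu z.
Proof.
have [k Hk] := energy_coercive.
(* The energy is positive outside this ball and 0 at its center, so a minimizer over the ball is
   global. *)
pose A := [set x : 'rV[R]_n | enorm x <= k.+1%:R].
have A0 : A 0 by rewrite /A/= enorm0.
have [| | |c cA cmin] := @EVT_min_rV R n (energy G mu) A.
- by exists 0.
- apply: bounded_closed_compact.
    exists k.+1%:R; split=> [|N kN x Ax]; first exact: num_real.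
    by apply: le_trans (normr_le_enorm x) _; apply: le_trans Ax _; exact: ltW.
  exact: (closed_comp (fun x _ => @enorm_continuous R n x) (@closed_le R _)).
- by apply: continuous_subspaceT; exact: energy_continuous gM gG.
exists c => z; have [zA|zA] := leP (enorm z) k.+1%:R.
  by apply: cmin; rewrite inE.
apply: le_trans (cmin 0 _) _; rewrite ?inE//.
rewrite /energy; under eq_Rintegral do rewrite add0r subrr.
by rewrite Rintegral_cst// mul0r; apply: ltW; apply: Hk; exact: ltW.
Qed.

End coercivity.

(** * Strict convexity of the energy and uniqueness *)

(** A line is cut out by finitely many linear equations. Closedness makes its complement a Borel
    set. *)
Lemma closed_line (R : realType) (n : nat) (L : set 'rV[R]_n) :
  is_line L -> closed L.
Proof.
move=> [a [d [d0 ->]]].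
have [j dj] : exists j, d ord0 j != 0.
  apply/existsP; apply: contraNT d0 => /existsPn d0.
  by apply/eqP/rowP => i; rewrite mxE; apply/eqP/negPn/d0.
(* dot z (w i) = 0 for all i iff z is parallel to d. *)
pose w i : 'rV[R]_n :=
  d ord0 j *: delta_mx ord0 i - d ord0 i *: delta_mx ord0 j.
have wE z i : dot z (w i) = d ord0 j * z ord0 i - d ord0 i * z ord0 j.
  by rewrite dotBr !dotZr !dot_delta.
rewrite (_ : [set _ | _ in _] =
    \bigcap_(i in [set: 'I_n]) [set y | dot y (w i) = dot a (w i)]).
  apply: closed_bigI => i _.
  exact: (closed_comp (fun y _ => @dot_continuous R n (w i) y)
    (@closed_eq R _)).
apply/seteqP; split=> [_ [t _ <-] i _ /=|y yL].
  by rewrite !wE !mxE; ring.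
exists ((d ord0 j)^-1 * (y ord0 j - a ord0 j)) => //.
apply/rowP => i; have := yL i I; rewrite /= !wE !mxE => yi.
apply: (mulfI dj); rewrite mulrDr mulrA mulVKf//.
apply/eqP; rewrite -subr_eq0; apply/eqP; lra.
Qed.

(** Collects what conditions (i) and (ii) share, so that only strictness of the convexity requires a
    case distinction. *)
Lemma profile_condP (R : realType) (n : nat) (g : R -> R)
    (mu : {measure set (borel_rV R n) -> \bar R}) : g 0 = 0 ->
  sincr_bounded g \/ incr_bounded_not_line g mu ->
  [/\ {in `[0, +oo[ &, {homo g : r s / r <= s}},
      exists M, forall r, 0 <= r -> `|g r| <= M
    & forall r, 0 < r -> 0 < g r].
Proof.
have bM : [bounded g r | r in `[0, +oo[] ->
    exists M, forall r, 0 <= r -> `|g r| <= M.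
  (* The bound is available for every number strictly above [M]. *)
  move=> [M [_ gM]]; exists (M + 1) => r r0.
  by apply: gM; rewrite /= ?ltrDl// in_itv/= r0.
move=> g0 [[g_incr gb]|[g_ndecr gb gpos _]]; last by split => //; exact: bM.
split; [exact: ltW_homo_in|exact: bM|move=> r r0].
by rewrite -g0; apply: g_incr; rewrite ?in_itv/= ?lexx ?ltW.
Qed.

Section strict_convexity.
Variables (R : realType) (n : nat) (g G : R -> R) (M : R).
Variable mu : {measure set (borel_rV R n) -> \bar R}.
Hypothesis mu_gt0 : (0 < mu [set: 'rV[R]_n])%E.
Hypothesis mu_fin : (mu [set: 'rV[R]_n] < +oo)%E.
Hypothesis g_cont : continuous (fun r : R => g `|r|).
Hypothesis g0 : g 0 = 0.
Hypothesis gM : forall r, 0 <= r -> `|g r| <= M.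
Hypothesis gG : mean_value_primitive g G.
Hypothesis g_mono : sincr_bounded g \/ incr_bounded_not_line g mu.
Implicit Types x y z : 'rV[R]_n.

(** The Bregman divergence of the function x -> G(|x + y|), that is, the gap in its subgradient
    inequality. *)
Definition bregman x z y : R :=
  G (enorm (z + y)) - G (enorm (x + y)) - dot (vfield g (x + y)) (z - x).

Lemma bcont_bregman x z : bcont (bregman x z).
Proof.
apply: bcontB; first exact: (bcont_potentialB gM gG z x).
exact: (bcont_dot_vfield g_cont g0 gM).
Qed.

Lemma Rintegral_bregman x z : \int[mu]_y bregman x z y =
  energy G mu z - energy G mu x - dot (Vfield g mu x) (z - x).
Proof.
rewrite RintegralB//; last 2 first.
- by apply: bcont_integrable => //; exact: (bcont_potentialB gM gG z x).
- by apply: bcont_integrable => //; exact: (bcont_dot_vfield g_cont g0 gM).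
by rewrite -(energyB mu_fin gM gG) -(dot_Vfield mu_fin g_cont g0 gM).
Qed.

Lemma bregman_ge0 x z y : 0 <= bregman x z y.
Proof.
have [g_ndecr _ _] := profile_condP g0 g_mono.
rewrite subr_ge0; have := potential_subgradient gG g0 g_ndecr (x + y) (z + y).
by rewrite opprD addrACA subrr addr0.
Qed.

Lemma bregman_eq0 x z y : bregman x z y = 0 ->
  dot (vfield g (x + y)) (z + y - (x + y))
    = G (enorm (z + y)) - G (enorm (x + y)).
Proof.
by move/eqP; rewrite subr_eq0 => /eqP ->; rewrite opprD addrACA subrr addr0.
Qed.

Lemma energy_subgradient x z :
  dot (Vfield g mu x) (z - x) <= energy G mu z - energy G mu x.
Proof.
rewrite -subr_ge0 -Rintegral_bregman; apply: Rintegral_ge0 => y _.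
exact: bregman_ge0.
Qed.

(** The gap must be nonzero on a set of positive measure. Under (i) it never vanishes; under (ii) it
    can vanish only on the line through [- x] and [- z], whose complement has positive measure. *)
Lemma energy_strict_subgradient x z : x != z ->
  dot (Vfield g mu x) (z - x) < energy G mu z - energy G mu x.
Proof.
move=> xz; rewrite -subr_gt0 -Rintegral_bregman.
have [g_ndecr _ gpos] := profile_condP g0 g_mono.
have pos A : measurable (A : set (borel_rV R n)) -> (0 < mu A)%E ->
    (forall y, A y -> bregman x z y != 0) -> 0 < \int[mu]_y bregman x z y.
  move=> mA muA Aneq0.
  apply: (Rintegral_gt0 mu_fin (bcont_bregman x z) _ mA muA).
    exact: bregman_ge0.
  by move=> y Ay; rewrite lt_neqAle eq_sym Aneq0// bregman_ge0.
have [[g_incr _]|[_ _ _ mu_line]] := g_mono.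
  apply: (pos setT) => // y _; apply: contra_neq xz => /bregman_eq0 H.
  exact: addIr (potential_strict_subgradient gG g0 g_incr H).
pose L := [set - x + t *: (z - x) | t in [set: R]].
have Lline : is_line L by exists (- x), (z - x); rewrite subr_eq0 eq_sym.
apply: (pos (~` L)).
- apply: sub_sigma_algebra; apply: closed_openC; exact: closed_line.
- exact: mu_line.
move=> y; apply: contra_notT; rewrite negbK => /eqP /bregman_eq0.
move=> /(potential_subgradient_eq gG g0 g_ndecr gpos).
set a := x + y; set b := z + y => par.
have zxE : z - x = b - a by rewrite /a /b opprD addrACA subrr addr0.
(* If the norms agree and are nonzero, then [a = b], against [x != z]; so [a = 0] and [y = - x]. *)
have [ab|ab] := eqVneq (enorm b) (enorm a).
  exists 0 => //; rewrite scale0r addr0.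
  suff a0 : a = 0 by apply/eqP; rewrite eq_sym -addr_eq0 addrC -/a a0.
  apply/eqP; rewrite -enorm_eq0; apply: contra_neqT xz => a0.
  by move: par; rewrite ab => /(scalerI a0) /addIr.
(* The relation [par] makes [a] this multiple of [b - a], and [y = - x + a]. *)
exists (enorm a / (enorm b - enorm a)) => //.
rewrite zxE (mulrC (enorm a)) -scalerA scalerBr -par -scalerBl scalerA.
by rewrite mulVf ?subr_eq0// scale1r addKr.
Qed.

Lemma Vfield_zero_uniq x z : Vfield g mu x = 0 -> Vfield g mu z = 0 -> x = z.
Proof.
move=> Vx Vz; apply/eqP/negPn/negP => xz.
have := energy_strict_subgradient xz; rewrite Vx dot0l => xz1.
by have := energy_subgradient z x; rewrite Vz dot0l; lra.
Qed.

End strict_convexity.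

(** * Weak convergence and continuous dependence *)

Lemma weak_cvg_bcont (R : realType) (n : nat)
    (mu_ : nat -> {measure set (borel_rV R n) -> \bar R})
    (mu : {measure set (borel_rV R n) -> \bar R}) (f : 'rV[R]_n -> R) :
  weak_cvg mu_ mu -> bcont f ->
  \int[mu_ k]_y f y @[k --> \oo] --> \int[mu]_y f y.
Proof.
move=> mu_cvg [fc [M fM]]; apply: mu_cvg => //.
exists M; split; first exact: num_real.
by move=> N MN y _; apply: le_trans (fM y) _; exact: ltW.
Qed.

(** Serves to bound the Lipschitz constants of the energies uniformly for large [k]. *)
Lemma weak_cvg_mass (R : realType) (n : nat)
    (mu_ : nat -> {measure set (borel_rV R n) -> \bar R})
    (mu : {measure set (borel_rV R n) -> \bar R}) :
  weak_cvg mu_ mu ->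
  fine (mu_ k [set: 'rV[R]_n]) @[k --> \oo] --> fine (mu [set: 'rV[R]_n]).
Proof.
move=> /weak_cvg_bcont /(_ (bcont_cst n 1)); rewrite Rintegral_cst// mul1r.
by under eq_cvg do rewrite Rintegral_cst// mul1r.
Qed.

Section quasiconvexity.
Variables (R : realType) (n : nat) (g G : R -> R) (M : R).
Variable mu : {measure set (borel_rV R n) -> \bar R}.
Hypothesis mu_gt0 : (0 < mu [set: 'rV[R]_n])%E.
Hypothesis mu_fin : (mu [set: 'rV[R]_n] < +oo)%E.
Hypothesis g_cont : continuous (fun r : R => g `|r|).
Hypothesis g0 : g 0 = 0.
Hypothesis gM : forall r, 0 <= r -> `|g r| <= M.
Hypothesis gG : mean_value_primitive g G.
Hypothesis g_mono : sincr_bounded g \/ incr_bounded_not_line g mu.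

(** The subgradient inequalities at the intermediate point towards [x] and [z], weighted by [1 - s]
    and [s], add up so that the gradient terms cancel. *)
Lemma energy_segment_le (x z : 'rV[R]_n) (s : R) : 0 <= s -> s <= 1 ->
  energy G mu z <= energy G mu x ->
  energy G mu (x + s *: (z - x)) <= energy G mu x.
Proof.
move=> s0 s1 zx; set p := x + _.
have hx := energy_subgradient mu_fin g_cont g0 gM gG g_mono p x.
have hz := energy_subgradient mu_fin g_cont g0 gM gG g_mono p z.
have px : x - p = - s *: (z - x) by rewrite /p opprD addNKr scaleNr.
have pz : z - p = (1 - s) *: (z - x).
  by rewrite scalerBl scale1r /p opprD addrA.
rewrite px dotZr in hx; rewrite pz dotZr in hz.
by move: hx hz; set D := dot _ _; nra.
Qed.

End quasiconvexity.

Section continuous_dependence.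
Variables (R : realType) (n : nat) (g G : R -> R) (M : R).
Variable mu : {measure set (borel_rV R n) -> \bar R}.
Variable mu_ : nat -> {measure set (borel_rV R n) -> \bar R}.
Hypothesis mu_gt0 : (0 < mu [set: 'rV[R]_n])%E.
Hypothesis mu_fin : (mu [set: 'rV[R]_n] < +oo)%E.
Hypothesis mu_k_fin : forall k, (mu_ k [set: 'rV[R]_n] < +oo)%E.
Hypothesis mu_cvg : weak_cvg mu_ mu.
Hypothesis g_cont : continuous (fun r : R => g `|r|).
Hypothesis g0 : g 0 = 0.
Hypothesis gM : forall r, 0 <= r -> `|g r| <= M.
Hypothesis gG : mean_value_primitive g G.
Hypothesis g_mono : sincr_bounded g \/ incr_bounded_not_line g mu.
Hypothesis g_mono_k :
  forall k, sincr_bounded g \/ incr_bounded_not_line g (mu_ k).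

(** Weak convergence settles a single point, the Lipschitz bound a neighborhood of it, and
    compactness makes [k] uniform. The sphere is one of the sup norm. *)
Lemma energy_gt_sphere (x0 : 'rV[R]_n) (e : R) : 0 < e -> Vfield g mu x0 = 0 ->
  \forall k \near \oo, [set p | `|p - x0| = e] `<=`
    [set p | energy G (mu_ k) x0 < energy G (mu_ k) p].
Proof.
move=> e0 Vx0.
have Scompact : compact [set p | `|p - x0| = e].
  apply: bounded_closed_compact.
    exists (`|x0| + e); split=> [|N eN p /= pe]; first exact: num_real.
    rewrite -[p](subrK x0); apply: le_trans (ler_normD _ _) _.
    by rewrite pe addrC ltW.
  apply: (closed_comp (f := fun p : 'rV[R]_n => `|p - x0|) _ (@closed_eq R e)).
  move=> p _; apply: continuous_comp; last exact: norm_continuous.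
  by apply: continuousB; [exact|exact: cst_continuous].
have := (compact_near_coveringP _).1 Scompact _ \oo
  (fun k p => energy G (mu_ k) x0 < energy G (mu_ k) p) _; apply => p /= pe.
have M0 : 0 <= M by exact: le_trans (normr_ge0 _) (gM (lexx 0)).
have x0p : x0 != p.
  by apply: contraTneq e0 => x0p; rewrite -pe x0p subrr normr0 ltxx.
have := energy_strict_subgradient mu_gt0 mu_fin g_cont g0 gM gG g_mono x0p.
rewrite Vx0 dot0l (energyB mu_fin gM gG) => d0; set d := (X in 0 < X) in d0.
have dcvg : energy G (mu_ k) p - energy G (mu_ k) x0 @[k --> \oo] --> d.
  under eq_cvg do rewrite (energyB (mu_k_fin _) gM gG).
  exact: weak_cvg_bcont (bcont_potentialB gM gG p x0).
set W := fine (mu setT).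
have W0 : 0 <= W by exact: fine_ge0.
(* At [p] the energy gap exceeds [d / 2]; moving to [q] costs less than that, since the mass of
   [mu_ k] is below [W + 1]. *)
exists ([set q | M * (W + 1) * enorm (q - p) < d / 2],
  [set k | d / 2 < energy G (mu_ k) p - energy G (mu_ k) x0 /\
           fine (mu_ k setT) < W + 1]) => /=.
  split.
    have := @enorm_sub_continuous R n (M * (W + 1)) p p.
    rewrite /continuous_at subrr enorm0 mulr0 => /cvgr_lt; apply; lra.
  apply: filterI.
    by apply: (cvgr_gt d dcvg); lra.
  by apply: (cvgr_lt W (weak_cvg_mass mu_cvg)); lra.
move=> [q k] /= [qp [kp kW]].
have := energy_lipschitz (mu_k_fin k) gM gG q p.
rewrite ler_norml => /andP[h _].
have Wk : M * enorm (q - p) * fine (mu_ k setT) <= M * enorm (q - p) * (W + 1).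
  by rewrite ler_wpM2l ?mulr_ge0 ?enorm_ge0// ltW.
rewrite mulrAC in qp; lra.
Qed.

(** A zero outside the sphere has energy at most that of [x0], so by quasiconvexity the segment
    joining them cannot cross the sphere at higher energy. *)
Lemma Vfield_zero_cvg (x0 : 'rV[R]_n) (z : nat -> 'rV[R]_n) :
  Vfield g mu x0 = 0 -> (forall k, Vfield g (mu_ k) (z k) = 0) ->
  z k @[k --> \oo] --> x0.
Proof.
move=> Vx0 Vz; apply/cvgrPdist_le => e e0.
apply: filterS (energy_gt_sphere e0 Vx0) => k sphere.
rewrite distrC leNgt; apply/negP => ez.
have zn : 0 < `|z k - x0| by apply: lt_trans ez.
(* Puts the point of the segment at distance exactly [e] from [x0]. *)
pose s := e / `|z k - x0|.
have s0 : 0 < s by rewrite divr_gt0.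
have := sphere (x0 + s *: (z k - x0)).
rewrite /= addrAC subrr add0r normrZ gtr0_norm// divfK ?gt_eqF// => /(_ erefl).
apply/negP; rewrite -leNgt.
apply: (energy_segment_le (mu_k_fin k) g_cont g0 gM gG (g_mono_k k)) => //.
- exact: ltW.
- by rewrite ler_pdivrMr// mul1r ltW.
have := energy_subgradient (mu_k_fin k) g_cont g0 gM gG (g_mono_k k) (z k) x0.
by rewrite Vz dot0l subr_ge0.
Qed.

End continuous_dependence.

(** * Properties of the profile, and assembly of the three claims *)

(** The even extension of [g] replaces continuity on the half-line by continuity everywhere. *)
Lemma continuous_comp_normr (R : realType) (g : R -> R) :
  {within `[0, +oo[, continuous g} -> continuous (fun r : R => g `|r|).
Proof.
move=> /subspace_continuousP gc r; have r0 : `[0, +oo[%classic `|r|.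
  by rewrite /= in_itv/= normr_ge0.
move=> P /(gc _ r0) gP.
apply: (@filterS _ (nbhs r) _ _ _ _ (@norm_continuous _ R^o r _ gP)) => t.
by apply; rewrite /= in_itv/= normr_ge0.
Qed.

Lemma bounded_of_cvg_pinfty (R : realType) (g : R -> R) (l : R) :
  continuous (fun r : R => g `|r|) -> g r @[r --> +oo] --> l ->
  exists M, forall r, 0 <= r -> `|g r| <= M.
Proof.
move=> gc gl.
have [a [_ ga]] : \forall r \near +oo, `|g r| <= `|l| + 1.
  by apply: (cvgr_le `|l| (cvg_norm gl)); lra.
(* The eventual bound holds strictly beyond [a], hence [a + 1]; the maximum with 0 keeps the
   interval nonempty. *)
have [b _ bM] := @EVT_max R (fun r => `|g `|r| |) 0 (Num.max 0 (a + 1))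
  ltac:(by rewrite le_max lexx) ltac:(by apply: continuous_subspaceT => r;
    apply: continuous_comp; [exact: gc|exact: norm_continuous]).
exists (Num.max (`|l| + 1) `|g `|b| |) => r r0; rewrite le_max.
have [ra|ar] := leP r (Num.max 0 (a + 1)).
  have := bM r; rewrite in_itv/= r0 ra (ger0_norm r0) => /(_ isT) ->.
  by rewrite orbT.
by rewrite ga//; move: ar; rewrite gt_max => /andP[_]; lra.
Qed.

Theorem theorem4 (R : realType) (n : nat) (hn : (1 <= n)%N) (g : R -> R)
  (g_cont : {within `[0, +oo[, continuous g}) (g0 : g 0 = 0)
  (mu : {measure set (borel_rV R n) -> \bar R})
  (mu_gt0 : (0 < mu [set: 'rV[R]_n])%E)
  (mu_fin : (mu [set: 'rV[R]_n] < +oo)%E) :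
  [/\ (* (a) existence *)
      forall l : R, 0 < l -> g r @[r --> +oo] --> l ->
        exists xc : 'rV[R]_n, Vfield g mu xc = 0,
      (* (b) uniqueness *)
      sincr_bounded g \/ incr_bounded_not_line g mu ->
        exists! xc : 'rV[R]_n, Vfield g mu xc = 0
    & (* (c) continuous dependence *)
      forall mu_ : nat -> {measure set (borel_rV R n) -> \bar R},
        (forall k, (0 < mu_ k [set: 'rV[R]_n])%E) ->
        (forall k, (mu_ k [set: 'rV[R]_n] < +oo)%E) ->
        weak_cvg mu_ mu ->
        sincr_bounded g \/
          (incr_bounded_not_line g mu /\ forall k, incr_bounded_not_line g (mu_ k)) ->
        x_c g (mu_ k) @[k --> \oo] --> x_c g mu].
Proof.
have gc := continuous_comp_normr g_cont.
have [G GP] := primitive_mvt gc.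
(* The mean value point exceeds [r >= 0], so the absolute value disappears. *)
have gG : mean_value_primitive g G.
  move=> r s r0 rs; have [c cI E] := GP r s r0 rs; exists c => //.
  by rewrite E ger0_norm//; lra.
(* Under (i) or (ii), [g] is at least [g 1 > 0] beyond 1, which is enough for coercivity. *)
have exist (nu : {measure set (borel_rV R n) -> \bar R}) :
    (0 < nu [set: 'rV[R]_n])%E -> (nu [set: 'rV[R]_n] < +oo)%E ->
    sincr_bounded g \/ incr_bounded_not_line g nu ->
    exists xc, Vfield g nu xc = 0.
  move=> nu_gt0 nu_fin g_mono.
  have [g_ndecr [M gM] gpos] := profile_condP g0 g_mono.
  have g_ge r : 1 <= r -> g 1 <= g r.
    by move=> r1; apply: profile_le => //; lra.
  have [xc xcmin] :=
    energy_minimizer nu_gt0 nu_fin gM gG (gpos 1 ltr01) ler01 g_ge.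
  by exists xc; exact: (Vfield_eq0_of_min nu_fin gc g0 gM gG xcmin).
split=> [l l0 gl|g_mono|mu_ mu_gt0_k mu_fin_k mu_cvg g_mono].
- have [M gM] := bounded_of_cvg_pinfty gc gl.
  (* Half the limit serves as the constant [m] of coercivity. *)
  have [a [_ ga]] : \forall r \near +oo, l / 2 <= g r.
    by apply: (cvgr_ge l gl); lra.
  have g_ge r : Num.max 0 (a + 1) <= r -> l / 2 <= g r.
    by rewrite ge_max => /andP[_ ar]; apply: ga; lra.
  have [||xc xcmin] := energy_minimizer mu_gt0 mu_fin gM gG _ _ g_ge.
  + by rewrite divr_gt0.
  + by rewrite le_max lexx.
  by exists xc; exact: (Vfield_eq0_of_min mu_fin gc g0 gM gG xcmin).
- have [_ [M gM] _] := profile_condP g0 g_mono.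
  have [xc Vxc] := exist mu mu_gt0 mu_fin g_mono.
  exists xc; split=> // z.
  exact: (Vfield_zero_uniq mu_gt0 mu_fin gc g0 gM gG g_mono Vxc).
have g_mono_mu : sincr_bounded g \/ incr_bounded_not_line g mu.
  by case: g_mono => [|[]]; [left|right].
have g_mono_k k : sincr_bounded g \/ incr_bounded_not_line g (mu_ k).
  by case: g_mono => [|[_ /(_ k)]]; [left|right].
have [_ [M gM] _] := profile_condP g0 g_mono_mu.
(* Existence of a zero rules out the default value of [x_c]. *)
have x_cP nu : (exists xc, Vfield g nu xc = 0) -> Vfield g nu (x_c g nu) = 0.
  exact: (@xgetPex _ 0 [set x | Vfield g nu x = 0]).
apply: (Vfield_zero_cvg mu_gt0 mu_fin mu_fin_k mu_cvg gc g0 gM gG) => //.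
- by apply: x_cP; exact: exist.
- by move=> k; apply: x_cP; exact: exist.
Qed.
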